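(* For all integers $n\ge 0$, $$x\sum_{l=0}^{n}{n \brace l}J_l(x)(-1)^{n-l-1}=\sum_{l=0}^{n}\binom{n}{l}2^l\phi_l(x)\phi_{n+1-l}(-x).$$
   Context: All identities are between polynomials in an indeterminate $x$ with real coefficients. For $n\ge 0$, $K_n(x)=n!\sum_{k=0}^{n}\binom{n+k+1}{n-k}\frac{x^k}{k!}$. The polynomials $J_n(x)$ are defined by $J_0(x)=1$ and $J_n(x)=K_n(x)-nK_{n-1}(x)$ for $n\ge 1$; equivalently $J_n(x)=n!\sum_{k=0}^{n}\binom{n+k}{n-k}\frac{x^k}{k!}$ for $n\ge 0$. ${n \brace k}$ denotes the Stirling numbers of the second kind, given by $\frac{1}{k!}(e^t-1)^k=\sum_{n=k}^{\infty}{n \brace k}\frac{t^n}{n!}$. The Bell polynomials are $\phi_n(x)=\sum_{k=0}^{n}{n \brace k}x^k$, $n\ge 0$. Here $(-1)^{n-l-1}$ with $l=n$ means $(-1)^{-1}=-1$. *)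

(* Defs.v *)
(* MathComp, with the abstract real numbers of MathComp-Analysis. *)
From mathcomp Require Import all_boot all_order all_algebra.
From mathcomp Require Import reals.

Set Implicit Arguments.
Unset Strict Implicit.
Unset Printing Implicit Defensive.

Import Order.TTheory GRing.Theory Num.Theory.
Local Open Scope ring_scope.

Section Definitions.
Variable R : realType.

(* A formal power series in t is its coefficient sequence [nat -> R]. *)
Definition fps_one : nat -> R := fun n => (n == 0%N)%:R.

Definition fps_mul (a b : nat -> R) : nat -> R :=
  fun n => \sum_(i < n.+1) a i * b (n - i)%N.

Definition fps_pow (a : nat -> R) (k : nat) : nat -> R :=
  iter k (fps_mul a) fps_one.

(* e^t - 1 *)
Definition fps_expm1 : nat -> R :=
  fun n => (n`!%:R)^-1 - fps_one n.

(* Stirling numbers of the second kind: (e^t - 1)^k / k! is the exponential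
   generating function of [fun n => stirling2 n k]. The coefficients for n < k
   vanish, as (e^t - 1)^k is divisible by t^k. *)
Definition stirling2 (n k : nat) : R :=
  n`!%:R * ((k`!%:R)^-1 * fps_pow fps_expm1 k n).

Definition bell_poly (n : nat) : {poly R} :=
  \sum_(k < n.+1) stirling2 n k *: 'X^k.

Definition K_poly (n : nat) : {poly R} :=
  n`!%:R *: \sum_(k < n.+1) ('C(n + k + 1, n - k)%:R / k`!%:R) *: 'X^k.

Definition J_poly (n : nat) : {poly R} :=
  if n is m.+1 then K_poly n - n%:R *: K_poly m else 1.

End Definitions.

(* Main.v *)
Require Import Defs.
From mathcomp Require Import all_boot all_order all_algebra.
From mathcomp Require Import reals.
From mathcomp Require Import ring zify.

Set Implicit Arguments.
Unset Strict Implicit.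
Unset Printing Implicit Defensive.

Import Order.TTheory GRing.Theory Num.Theory.
Local Open Scope ring_scope.

(** The theorem compares the coefficients of two exponential generating
    functions in t.  As 2^l phi_l(x) and phi_l(-x) have the generating functions
    exp(x (e^(2t) - 1)) and exp(-x (e^t - 1)), and the index n + 1 - l stands for
    a derivative of the latter, the right-hand side has the generating function
      exp(x (e^(2t) - 1)) * d/dt exp(-x (e^t - 1))
        = - x e^t exp(x (e^(2t) - e^t)).
    On the left, the J_l have the generating function
    (1 - z)^(-1) exp(x z / (1 - z)^2), and summing against
    (-1)^(n - l) stirling2 n l amounts to substituting z = 1 - e^(-t), which
    gives e^t exp(x (e^(2t) - e^t)); the exponent n - l - 1 supplies the sign and
    the factor x is the one in front of the sum.

    The proof turns this substitution into an induction on n.  The functions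
    G_m(t) = e^((m+1) t) exp(x (e^(2t) - e^t)) form a family closed under
    differentiation:
      G_m' = (m + 1) G_m + x (2 G_(m+2) - G_(m+1)).
    Since z = 1 - e^(-t), d/dt corresponds to (1 - z) d/dz, which acts on
    coefficients by a_l |-> a_(l+1) - l a_l; that this operator becomes the shift
    is the Stirling recurrence [stirling_transformS].  On the z side, the family
    is [JK_poly], with J and K as its first two members, and it obeys the
    differential equation by [JK_polyS], which is Pascal's rule in disguise.
    On the t side, G_m is a binomial convolution of r-Bell polynomials and obeys
    the same equation by [rbell_convS].  Both sides have constant term 1, so they
    agree for all m at once ([stirling_transform_JK]). *)

(** * Stirling numbers of the second kind *)

Section Stirling.
Variable R : realType.
Implicit Types a b : nat -> R.

(** The Leibniz rule: n.+1%:R * a n.+1 is the coefficient of t^n in the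
    derivative of a. *)
Lemma fps_mul_deriv a b n :
  n.+1%:R * fps_mul a b n.+1 =
    fps_mul (fun i => i.+1%:R * a i.+1) b n
    + fps_mul a (fun i => i.+1%:R * b i.+1) n.
Proof.
rewrite /fps_mul mulr_sumr.
(* the weight n + 1 = i + (n + 1 - i) is shared between the two factors *)
transitivity (\sum_(i < n.+2) i%:R * a i * b (n.+1 - i)%N +
              \sum_(i < n.+2) a i * ((n.+1 - i)%:R * b (n.+1 - i)%N)).
  rewrite -big_split; apply: eq_bigr => i _ /=.
  by rewrite natrB ?(leq_ord i) //; ring.
congr (_ + _).
  by rewrite big_ord_recl /= !mul0r add0r; apply: eq_bigr.
rewrite big_ord_recr /= subnn mul0r mulr0 addr0.
by apply: eq_bigr => i _; rewrite subSn // -ltnS.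
Qed.

Lemma fps_mul1l a n : fps_mul (@fps_one R) a n = a n.
Proof.
rewrite /fps_mul big_ord_recl /= /fps_one mul1r subn0 big1 ?addr0 // => i _.
by rewrite mul0r.
Qed.

Lemma fps_expm1_deriv n :
  n.+1%:R * fps_expm1 R n.+1 = fps_expm1 R n + fps_one R n.
Proof.
rewrite /fps_expm1 subrK /fps_one subr0 factS natrM invfM mulVKf //.
by rewrite pnatr_eq0.
Qed.

(** With E = e^t - 1 and E' = E + 1, this is (E^k)' = k E^(k-1) E' read off at
    t^n; at k = 0 the factor k%:R cancels the spurious term due to 0.-1 = 0. *)
Lemma fps_pow_expm1_deriv k n :
  n.+1%:R * fps_pow (fps_expm1 R) k n.+1 =
    k%:R * (fps_pow (fps_expm1 R) k n + fps_pow (fps_expm1 R) k.-1 n).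
Proof.
elim: k n => [|k IHk] n; first by rewrite mul0r /fps_pow /= /fps_one mulr0.
have mulDl a b c m :
  fps_mul (fun i => a i + b i) c m = fps_mul a c m + fps_mul b c m.
  by rewrite -big_split; apply: eq_bigr => i _; rewrite mulrDl.
rewrite /= [LHS]fps_mul_deriv.
under [X in X + _]eq_bigr => i _ do rewrite fps_expm1_deriv.
rewrite [X in X + _]mulDl fps_mul1l.
under [X in _ + X]eq_bigr => i _ do
  rewrite IHk mulrDr mulrDr mulrCA [_ * (k%:R * fps_pow _ k.-1 _)]mulrCA.
rewrite big_split -!mulr_sumr /=.
case: k {IHk} => [|k]; rewrite /fps_pow /= -/(fps_mul _ _ n).
  by rewrite !mul0r !addr0 mul1r.
by rewrite -/(fps_mul _ _ n) -(natr1 k.+1); ring.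
Qed.

Lemma stirling2_0 k : stirling2 R 0 k = (k == 0%N)%:R.
Proof.
rewrite /stirling2; case: k => [|k].
  by rewrite /fps_pow /= /fps_one eqxx fact0 invr1 !mul1r.
rewrite /fps_pow /= /fps_mul big_ord_recl big_ord0 /fps_expm1 /fps_one.
by rewrite eqxx fact0 invr1 subrr mul0r addr0 !mulr0.
Qed.

Lemma stirling2Sn0 n : stirling2 R n.+1 0 = 0.
Proof. by rewrite /stirling2 /fps_pow /= /fps_one !mulr0. Qed.

Lemma stirling2SS n k :
  stirling2 R n.+1 k.+1 = stirling2 R n k + k.+1%:R * stirling2 R n k.+1.
Proof.
rewrite /stirling2 !factS !natrM.
have -> : n.+1%:R * n`!%:R *
    ((k.+1%:R * k`!%:R)^-1 * fps_pow (fps_expm1 R) k.+1 n.+1) =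
  n`!%:R * ((k.+1%:R * k`!%:R)^-1
    * (n.+1%:R * fps_pow (fps_expm1 R) k.+1 n.+1)) by ring.
rewrite fps_pow_expm1_deriv /=.
have k1 : k.+1%:R != 0 :> R by rewrite pnatr_eq0.
have kf : k`!%:R != 0 :> R by rewrite pnatr_eq0 -lt0n fact_gt0.
by field; rewrite kf nat1r.
Qed.

Lemma stirling2_small n k : (n < k)%N -> stirling2 R n k = 0.
Proof.
elim: n k => [|n IHn] [|k] // lt_nk; first by rewrite stirling2_0.
by rewrite stirling2SS !IHn ?mulr0 ?addr0 //; apply: ltnW.
Qed.

(** On exponential generating functions, s = 1 substitutes e^t - 1 and s = -1
    substitutes 1 - e^(-t) for the variable. *)
Definition stirling_transform (s : R) (V : lmodType R) (a : nat -> V) n : V :=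
  \sum_(l < n.+1) (stirling2 R n l * s ^+ (n - l)) *: a l.

Lemma stirling_transform0 s (V : lmodType R) (a : nat -> V) :
  stirling_transform s a 0 = a 0%N.
Proof.
by rewrite /stirling_transform big_ord1 stirling2_0 expr0 mulr1 scale1r.
Qed.

(** If z = (e^(s t) - 1) / s then d/dt = (1 + s z) d/dz, and the right-hand side
    applies (1 + s z) d/dz to the generating function of a. *)
Lemma stirling_transformS s (V : lmodType R) (a : nat -> V) n :
  stirling_transform s a n.+1 =
    stirling_transform s (fun l => a l.+1 + (s * l%:R) *: a l) n.
Proof.
rewrite /stirling_transform big_ord_recl stirling2Sn0 mul0r scale0r add0r.
under eq_bigr => l _ do rewrite lift0 stirling2SS subSS mulrDl scalerDl.
under [RHS]eq_bigr => l _ do rewrite scalerDr.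
rewrite !big_split /=; congr (_ + _).
(* the index shift is free: the term at 0 has weight 0, the one at n + 1 has
   a vanishing Stirling number *)
rewrite big_ord_recr [RHS]big_ord_recl /= stirling2_small //.
rewrite !mulr0 mul0r !scale0r scaler0 addr0 add0r.
apply: eq_bigr => l _; rewrite /bump leq0n add1n scalerA; congr (_ *: _).
by rewrite -(subnSK (ltn_ord l)) exprS; ring.
Qed.

End Stirling.

(** * Bell and r-Bell polynomials *)

Section BellPolynomials.
Variable R : realType.

Lemma bell_polyE n : bell_poly R n = stirling_transform 1 (fun l => 'X^l) n.
Proof. by apply: eq_bigr => l _; rewrite expr1n mulr1. Qed.

Lemma bell_polyS n :
  bell_poly R n.+1 = 'X * ((bell_poly R n)^`() + bell_poly R n).
Proof.
rewrite !bell_polyE stirling_transformS raddf_sum -big_split mulr_sumr.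
apply: eq_bigr => l _; rewrite /= derivZ -scalerDr -scalerAr; congr (_ *: _).
rewrite mul1r derivXn mulrDr mulrnAr -!exprS addrC scaler_nat.
by case: (l : nat) => // m; rewrite !mulr0n.
Qed.

(** The r-Bell polynomials: rbell_poly r has the exponential generating function
    e^(r t) exp(x (e^t - 1)), and the recursion is the effect of d/dt on it.
    Letting r vary removes the need for the derivative in x. *)
Fixpoint rbell_poly (r n : nat) : {poly R} :=
  if n is m.+1 then r%:R * rbell_poly r m + 'X * rbell_poly r.+1 m else 1.

(** The same generating function has t-derivative (r + x e^t) times itself and
    x-derivative (e^t - 1) times itself; eliminating e^t gives this second
    recursion, which for r = 0 is the one of the Bell polynomials. *)
Lemma rbell_polyS r n :
  rbell_poly r n.+1 =
    'X * ((rbell_poly r n)^`() + rbell_poly r n) + r%:R * rbell_poly r n.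
Proof.
elim: n r => [|n IHn] r; first by rewrite /= derivC; ring.
have recE p m : rbell_poly p m.+1 =
  p%:R * rbell_poly p m + 'X * rbell_poly p.+1 m by [].
rewrite recE [in RHS]recE !IHn.
by rewrite derivD derivM derivM -polyC_natr derivC derivX; ring.
Qed.

Lemma bell_poly_rbell n : bell_poly R n = rbell_poly 0 n.
Proof.
elim: n => [|n IHn].
  by rewrite bell_polyE stirling_transform0.
by rewrite bell_polyS rbell_polyS IHn mul0r addr0.
Qed.

End BellPolynomials.

(** * A family of polynomials containing J and K *)

Section JK.
Variable R : realType.

(** JK_poly m has the exponential generating function
    (1 - z)^(-(m + 1)) exp(x z / (1 - z)^2).  The lower index 2k + m, rather than
    its complement l - k, makes the binomial vanish for k > l, so that the
    coefficient formula [coef_JK_poly] needs no bound on k. *)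
Definition JK_poly (m l : nat) : {poly R} :=
  \sum_(k < l.+1) (l`!%:R / k`!%:R * 'C(l + k + m, k.*2 + m)%:R) *: 'X^k.

Lemma coef_JK_poly m l k :
  (JK_poly m l)`_k = l`!%:R / k`!%:R * 'C(l + k + m, k.*2 + m)%:R.
Proof.
rewrite /JK_poly -(poly_def l.+1
  (fun k => l`!%:R / k`!%:R * 'C(l + k + m, k.*2 + m)%:R)).
rewrite coef_poly; case: ltnP => // lt_lk.
by rewrite bin_small ?mulr0 //; lia.
Qed.

Lemma JK_poly0 m : JK_poly m 0 = 1.
Proof.
by rewrite /JK_poly big_ord1 /= fact0 divr1 mul1r binn scale1r.
Qed.

(** This is (1 - z) F_m' = (m + 1) F_m + x (2 F_(m+2) - F_(m+1)) for the
    generating functions F_m; it holds because (1 - z) d/dz sends z / (1 - z)^2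
    to 2 / (1 - z)^2 - 1 / (1 - z). *)
Lemma JK_polyS m l :
  JK_poly m l.+1 - l%:R *: JK_poly m l =
    m.+1%:R *: JK_poly m l
    + 'X * (2 *: JK_poly m.+2 l - JK_poly m.+1 l).
Proof.
apply/polyP => k; rewrite coefD coefN !coefZ coefD coefZ coefXM.
case: k => [|k] /=.
  rewrite !coef_JK_poly !addn0 !add0n factS natrM.
  have H : (l + m).+1%:R * 'C(l + m, m)%:R = l.+1%:R * 'C(l.+1 + m, m)%:R :> R.
    by rewrite -!natrM addSn mul_bin_down -addSn addnK.
  apply/eqP; rewrite -subr_eq0; apply/eqP.
  transitivity (l`!%:R / 0`!%:R * (l.+1%:R * 'C(l.+1 + m, m)%:R
    - (l + m).+1%:R * 'C(l + m, m)%:R) : R); first by ring.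
  by rewrite H subrr mulr0.
rewrite coefB coefZ !coef_JK_poly.
have -> : (l + k + m.+2 = (l + k.+1 + m).+1)%N by lia.
have -> : (l.+1 + k.+1 + m = (l + k.+1 + m).+1)%N by lia.
have -> : (l + k + m.+1 = l + k.+1 + m)%N by lia.
have -> : (k.*2 + m.+2 = (k.*2 + m.+1).+1)%N by lia.
have -> : (k.+1.*2 + m = (k.*2 + m.+1).+1)%N by lia.
rewrite binS natrD.
(* after Pascal's rule only 'C(N, q) and 'C(N, q + 1) remain, with
   N = l + k + 1 + m and q = 2k + 1 + m, and the claim is their ratio *)
have H : (k.*2 + m.+1).+1%:R * 'C(l + k.+1 + m, (k.*2 + m.+1).+1)%:R =
    (l%:R - k%:R) * 'C(l + k.+1 + m, k.*2 + m.+1)%:R :> R.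
  case: (leqP k l) => [le_kl|lt_lk].
    rewrite -natrB // -!natrM mul_bin_left; congr ((_ * _)%:R); lia.
  by rewrite !bin_small ?mulr0 //; lia.
have -> : l`!%:R / k`!%:R = l`!%:R / k.+1`!%:R * k.+1%:R :> R.
  by rewrite factS natrM invfM mulrA mulrAC divfK // pnatr_eq0.
set F := k.+1`!%:R; rewrite factS natrM.
apply/eqP; rewrite -subr_eq0; apply/eqP.
transitivity (l`!%:R / F * ((l%:R - k%:R) * 'C(l + k.+1 + m, k.*2 + m.+1)%:R
  - (k.*2 + m.+1).+1%:R * 'C(l + k.+1 + m, (k.*2 + m.+1).+1)%:R) : R).
  by rewrite -muln2; ring.
by rewrite H subrr mulr0.
Qed.

(** Pascal's rule identifies the defining difference of J; the coefficient of K
    reappears with its binomial in the complementary form. *)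
Lemma J_polyE n : J_poly R n = JK_poly 0 n.
Proof.
have KE k : K_poly R k = JK_poly 1 k.
  rewrite /K_poly scaler_sumr; apply: eq_bigr => i _.
  rewrite scalerA mulrA mulrAC; congr (_ * _%:R *: _).
  rewrite -[RHS]bin_sub; first by congr 'C(_, _); have := ltn_ord i; lia.
  by have := ltn_ord i; lia.
case: n => [|n]; first by rewrite JK_poly0.
rewrite /J_poly !KE; apply/polyP => k.
rewrite coefB coefZ !coef_JK_poly factS natrM !addn0.
have -> : (n.+1 + k + 1 = (n.+1 + k).+1)%N by lia.
have -> : (n + k + 1 = n.+1 + k)%N by lia.
by rewrite addn1 binS natrD; ring.
Qed.

End JK.

(** * Binomial convolution *)

Section BinomialConvolution.
Variable A : comRingType.
Implicit Types a b : nat -> A.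

Definition binom_conv a b n : A :=
  \sum_(l < n.+1) 'C(n, l)%:R * (a l * b (n - l)%N).

(** The Leibniz rule for products of exponential generating functions, on which
    d/dt is the shift. *)
Lemma binom_convS a b n :
  binom_conv a b n.+1 =
    binom_conv (fun l => a l.+1) b n + binom_conv a (fun l => b l.+1) n.
Proof.
rewrite /binom_conv big_ord_recl.
under eq_bigr => l _ do rewrite /= /bump leq0n add1n binS natrD mulrDl subSS.
rewrite big_split addrA addrC /=; congr (_ + _).
rewrite big_ord_recr [RHS]big_ord_recl /= (bin_small (ltnSn n)).
rewrite mulr0n mul0r addr0 !bin0 !subn0.
congr (_ + _); apply: eq_bigr => l _.
by rewrite /bump leq0n add1n subnSK.
Qed.

End BinomialConvolution.

(** * Comparison of the two sides *)

Section Comparison.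
Variable R : realType.

(** Coefficients of e^((2i + j) t) exp(x (e^(2t) - e^t)): the factors are
    e^(2it) exp(x (e^(2t) - 1)) and e^(jt) exp(-x (e^t - 1)). *)
Definition rbell_conv (i j : nat) : nat -> {poly R} :=
  binom_conv (fun l => 2 ^+ l * rbell_poly R i l)
             (fun l => rbell_poly R j l \Po (- 'X)).

Lemma rbell_convS i j n :
  rbell_conv i j n.+1 =
    (i.*2 + j)%:R * rbell_conv i j n
    + 'X * (2 * rbell_conv i.+1 j n - rbell_conv i j.+1 n).
Proof.
rewrite /rbell_conv binom_convS /binom_conv.
rewrite mulrBr !mulr_sumr -sumrB -!big_split /=; apply: eq_bigr => l _.
rewrite comp_polyD !comp_polyM comp_polyX.
by rewrite -[j%:R]polyC_natr comp_polyC polyC_natr exprS -muln2; ring.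
Qed.

Lemma rbell_conv0 i j : rbell_conv i j 0 = 1.
Proof. by rewrite /rbell_conv /binom_conv big_ord1 /= comp_polyC !mulr1. Qed.

(** Both families start at 1 and satisfy the same recurrence in n, which raises
    2i + j by 1 or 2; the induction therefore runs over all i and j together.
    The offset j.+1 accounts for the exponent m + 1 of [JK_poly m]. *)
Lemma stirling_transform_JK i j n :
  stirling_transform (-1) (JK_poly R (i.*2 + j)) n = rbell_conv i j.+1 n.
Proof.
elim: n i j => [|n IHn] i j.
  by rewrite stirling_transform0 rbell_conv0 JK_poly0.
rewrite stirling_transformS rbell_convS -!IHn.
rewrite !mulr_sumr -sumrB mulr_sumr -big_split.
apply: eq_bigr => l _ /=.
rewrite mulN1r scaleNr JK_polyS doubleS !addSn addnS.
by rewrite -!mul_polyC !polyC_natr; ring.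
Qed.

End Comparison.

Theorem theorem3p6 (R : realType) (n : nat) :
  'X * \sum_(l < n.+1)
         (stirling2 R n l * (-1) ^ (n%:Z - l%:Z - 1)) *: J_poly R l
  = \sum_(l < n.+1)
      ('C(n, l)%:R * 2 ^+ l) *:
        (bell_poly R l * (bell_poly R (n + 1 - l) \Po (- 'X))).
Proof.
transitivity (- 'X * stirling_transform (-1) (JK_poly R 0) n).
  rewrite mulNr -mulrN -sumrN; congr (_ * _); apply: eq_bigr => l _.
  rewrite J_polyE -scaleNr -mulrN; congr (_ * _ *: _).
  rewrite subzn ?leq_ord // expfzDr ?oppr_eq0 ?oner_eq0 // exprN1 invrN1.
  by rewrite mulrN1.
rewrite (stirling_transform_JK R 0 0) mulr_sumr; apply: eq_bigr => l _.
(* phi_(m+1) = x r_1(m), with r_1 the r-Bell polynomials for r = 1, and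
   composing with - X turns the leading x into the factor - x *)
rewrite addn1 subSn ?leq_ord // !bell_poly_rbell.
rewrite [rbell_poly R 0 _.+1]/= mul0r add0r comp_polyM comp_polyX.
by rewrite -mul_polyC polyCM polyC_natr polyC_exp polyC_natr; ring.
Qed.
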